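(* (Setting (1)) There is a subgroup of $\mathbb{Z}^{\mathbb{N}}$ which is Menger-bounded, but is neither Hurewicz-bounded nor Rothberger-bounded, and has none of the Hurewicz, Menger, and Rothberger properties.
   Context: The group $\mathbb{Z}^{\mathbb{N}}$ carries pointwise addition and the product topology ($\mathbb{Z}$ discrete); subgroups carry the subspace topology. For a topological group $(G,\cdot)$, with the condition required for each sequence $(U_n)_{n\in\mathbb{N}}$ of neighborhoods of the unit: $G$ is Menger-bounded if there are finite $F_n\subseteq G$ with $G=\bigcup_n F_n\cdot U_n$; Hurewicz-bounded if there are finite $F_n\subseteq G$ such that each $g\in G$ belongs to $F_n\cdot U_n$ for all but finitely many $n$; Rothberger-bounded if there are $a_n\in G$ with $G=\bigcup_n a_n\cdot U_n$. For a topological space $X$, with the condition required for each sequence $(\mathcal{U}_n)_{n\in\mathbb{N}}$ of open covers of $X$: $X$ has the Menger property if there are finite $\mathcal{F}_n\subseteq\mathcal{U}_n$ such that $\bigcup_n\mathcal{F}_n$ covers $X$; the Hurewicz property if there are finite $\mathcal{F}_n\subseteq\mathcal{U}_n$ such that each $x\in X$ belongs to $\bigcup_{U\in\mathcal{F}_n}U$ for all but finitely many $n$; the Rothberger property if there are $U_n\in\mathcal{U}_n$ with $X=\bigcup_n U_n$. *)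

(* Defs.v *)
From HB Require Import structures.
From mathcomp Require Import all_boot all_order all_algebra.
From mathcomp Require Import all_classical all_reals.
From mathcomp Require Import topology tvs.

Set Implicit Arguments.
Unset Strict Implicit.
Unset Printing Implicit Defensive.

Import Order.TTheory GRing.Theory Num.Theory.
Local Open Scope classical_set_scope.
Local Open Scope ring_scope.

(* Groups are written additively. *)
Section GroupBoundedness.
Variable G : topologicalZmodType.

Definition Menger_bounded : Prop :=
  forall U : nat -> set G, (forall n, nbhs (0 : G) (U n)) ->
  exists F : nat -> set G, (forall n, finite_set (F n)) /\
    \bigcup_n [set a + u | a in F n & u in U n] = [set: G].

Definition Hurewicz_bounded : Prop :=
  forall U : nat -> set G, (forall n, nbhs (0 : G) (U n)) ->
  exists F : nat -> set G, (forall n, finite_set (F n)) /\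
    forall g : G, \forall n \near \oo, [set a + u | a in F n & u in U n] g.

Definition Rothberger_bounded : Prop :=
  forall U : nat -> set G, (forall n, nbhs (0 : G) (U n)) ->
  exists a : nat -> G, \bigcup_n [set a n + u | u in U n] = [set: G].

End GroupBoundedness.

Section SelectionProperties.
Variable X : topologicalType.

Definition open_cover (C : set (set X)) : Prop :=
  C `<=` open /\ \bigcup_(V in C) V = [set: X].

Definition Menger : Prop :=
  forall C : nat -> set (set X), (forall n, open_cover (C n)) ->
  exists F : nat -> set (set X),
    (forall n, finite_set (F n) /\ F n `<=` C n) /\
    \bigcup_n \bigcup_(V in F n) V = [set: X].

Definition Hurewicz : Prop :=
  forall C : nat -> set (set X), (forall n, open_cover (C n)) ->
  exists F : nat -> set (set X),
    (forall n, finite_set (F n) /\ F n `<=` C n) /\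
    forall x : X, \forall n \near \oo, (\bigcup_(V in F n) V) x.

Definition Rothberger : Prop :=
  forall C : nat -> set (set X), (forall n, open_cover (C n)) ->
  exists V : nat -> set X,
    (forall n, C n (V n)) /\ \bigcup_n V n = [set: X].

End SelectionProperties.

(* A subgroup as a type of its own. The library's [subspace H] does not fit
   here: it keeps the points outside H, as isolated points. *)
Section Subgroup.
Variables (G : topologicalZmodType) (H : zmodClosed G).

Definition subgroup : Type := {x : G | x \in H}.

HB.instance Definition _ := SubChoice.on subgroup.
HB.instance Definition _ := [SubChoice_isSubZmodule of subgroup by <:].
HB.instance Definition _ :=
  Topological.copy subgroup (initial_topology (val : subgroup -> G)).

Let val_continuous : continuous (val : subgroup -> G).
Proof. exact: (@initial_continuous subgroup G val). Qed.

Let subgroup_sub_continuous :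
  continuous (fun x : subgroup * subgroup => x.1 - x.2).
Proof.
apply: (@continuous_comp_initial subgroup (subgroup * subgroup)%type G val).
move=> x; rewrite (_ : _ \o _ = fun x => val x.1 - val x.2); last first.
  by apply/funext => y; exact: GRing.valB.
apply: (@continuous_comp _ _ _
  (fun x : subgroup * subgroup => (val x.1, val x.2))
  (fun x : G * G => x.1 - x.2)); last exact: sub_continuous.
apply: cvg_pair; apply: continuous_comp; do ?exact: val_continuous.
  exact: cvg_fst.
exact: cvg_snd.
Qed.

HB.instance Definition _ :=
  PreTopologicalNmodule_isTopologicalZmodule.Build subgroup
    subgroup_sub_continuous.

End Subgroup.

Definition ZN : Type := {ptws nat -> discrete_topology int}.

HB.instance Definition _ :=
  Topological.copy ZN {ptws nat -> discrete_topology int}.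
HB.instance Definition _ := GRing.Zmodule.copy ZN (nat -> int).

Lemma ZN_sub_continuous : continuous (fun x : ZN * ZN => x.1 - x.2).
Proof.
have nbhs_eq (f : ZN) (i : nat) : nbhs f [set g : ZN | g i = f i].
  have /(_ f [set f i]) := @proj_continuous nat (fun=> discrete_topology int) i.
  by apply; exact: discrete_set1.
move=> x; apply/cvg_sup => i U [_ [[W oW <-] /= Wx] sWU].
apply: filterS sWU _; exists ([set g : ZN | g i = x.1 i], [set g : ZN | g i = x.2 i]).
  by split; exact: nbhs_eq.
move=> y /= [y1 y2]; move: Wx.
by rewrite /= !fctE y1 y2.
Qed.

HB.instance Definition _ :=
  PreTopologicalNmodule_isTopologicalZmodule.Build ZN ZN_sub_continuous.

(* Main.v *)
(* Fix a nonprincipal ultrafilter U. Let the subgroup consist of the integer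
   sequences g whose partial maximum max_{i <= n} |g i| is at most c (n + 1) for
   U-many n, for some c: the ultrafilter makes this class closed under sums. Since
   the linear bound holds infinitely often, the group is Menger-bounded; since it
   may fail on the complement of a set in U, the partial maxima are unbounded for
   eventual domination, so the group is not Hurewicz-bounded. Being bounded by a
   constant is allowed, so 0/1-valued sequences diagonalize against any attempt at
   Rothberger-boundedness. To destroy the Menger property, part of the coordinates
   carries a second condition: a root coordinate 0 equals the sum of each row of
   an N x N array of cells. The graphs of functions N -> N then lie in the group,
   and form there a closed copy of the Baire space. *)

From HB Require Import structures.
Require Import Defs.
From mathcomp Require Import all_boot all_algebra all_classical topology tvs.
From mathcomp Require Import all_order zify.

Set Implicit Arguments.
Unset Strict Implicit.
Unset Printing Implicit Defensive.

Import Order.TTheory GRing.Theory Num.Theory.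
Local Open Scope classical_set_scope.
Local Open Scope ring_scope.

(** * Implications between the covering properties *)

Lemma Hurewicz_Menger (X : topologicalType) : Hurewicz X -> Menger X.
Proof.
move=> HX C /HX[F [CF Fx]]; exists F; split => //.
by apply/seteqP; split => // x _; have [n _ /(_ n (leqnn n)) Vx] := Fx x; exists n.
Qed.

Lemma Rothberger_Menger (X : topologicalType) : Rothberger X -> Menger X.
Proof.
move=> RX C /RX[V [CV VT]]; exists (fun n => [set V n]); split => [n|].
  by split; [exact: finite_set1|move=> _ ->].
by rewrite -VT; apply: eq_bigcupr => n _; rewrite bigcup_set1.
Qed.

(** * Neighborhoods and finite windows in subgroups of Z^N *)

Lemma val_subgroupD (H : zmodClosed ZN) (a b : subgroup H) i :
  val (a + b) i = (val a i : int) + val b i.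
Proof. by []. Qed.

Lemma val_subgroupB (H : zmodClosed ZN) (a b : subgroup H) i :
  val (a - b) i = (val a i : int) - val b i.
Proof. by []. Qed.

Lemma nbhs0_subgroup (H : zmodClosed ZN) (U : set (subgroup H)) :
  nbhs (0 : subgroup H) U ->
  exists k : nat, forall g, (forall i, (i < k)%N -> val g i = 0) -> U g.
Proof.
(* The filter generated by the cylinders around 0; its convergence to 0, checked one coordinate at a
   time, makes these cylinders a neighborhood base. *)
pose F : set_system ZN :=
  [set V | exists k : nat, forall g : ZN, (forall i, (i < k)%N -> g i = 0) -> V g].
have FF : Filter F.
  split.
  - by exists 0%N.
  - move=> P Q [k kP] [l lQ]; exists (maxn k l) => g g0.
    by split; [apply: kP|apply: lQ] => i ilt; apply: g0; rewrite leq_max ilt ?orbT.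
  - by move=> P Q PQ [k kP]; exists k => g /kP/PQ.
have F0 : F --> (0 : ZN).
  apply/cvg_sup => i V [_ [[W oW <-] /= W0] sWV].
  exists i.+1 => g g0; apply: sWV => /=.
  by rewrite g0.
move=> [_ [[W oW <-] /= W0] sWU].
have [|k kW] := F0 W; first exact: open_nbhs_nbhs.
by exists k => g g0; apply: sWU; exact: kW.
Qed.

Lemma subgroup_coord_continuous (H : zmodClosed ZN) (i : nat) :
  continuous (fun g : subgroup H => val g i : discrete_topology int).
Proof.
move=> g; apply: (@continuous_comp _ _ _ (val : subgroup H -> ZN)
  (fun f : ZN => f i : discrete_topology int)).
  exact: (@initial_continuous (subgroup H) ZN val).
exact: (@proj_continuous nat (fun=> discrete_topology int) i).
Qed.

Lemma open_subgroup_coord (H : zmodClosed ZN) (i : nat) (P : set int) :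
  open [set g : subgroup H | P (val g i)].
Proof.
apply: (@open_comp _ _ (fun g : subgroup H => val g i : discrete_topology int) P).
  by move=> g _; exact: subgroup_coord_continuous.
exact: discrete_open.
Qed.

Lemma nbhs0_coord (H : zmodClosed ZN) (i : nat) :
  nbhs (0 : subgroup H) [set g : subgroup H | val g i = 0].
Proof.
apply: open_nbhs_nbhs; split; last by [].
exact: (@open_subgroup_coord H i [set 0]).
Qed.

(** There are finitely many patterns with entries in [-B, B] on k coordinates. The translates must
    lie in [H], so each pattern is represented by an element of [H] realizing it, or by the default
    0 if there is none. *)
Lemma finite_set_windows (H : zmodClosed ZN) (k B : nat) :
  exists F : set (subgroup H), finite_set F /\
    forall g : subgroup H, (forall i, (i < k)%N -> `|val g i| <= B%:Z) ->
    exists2 a, F a & forall i, (i < k)%N -> val a i = val g i.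
Proof.
pose window (s : {ffun 'I_k -> 'I_B.*2.+1}) : set (subgroup H) :=
  [set a : subgroup H | forall i : 'I_k, val a i = (s i)%:Z - B%:Z].
exists [set xget 0 (window s) | s in setT]; split.
  exact/finite_image/finite_finset.
have shift (z : int) : `|z| <= B%:Z ->
    (absz (z + B%:Z)%R < B.*2.+1)%N /\ z = (absz (z + B%:Z)%R)%:Z - B%:Z by lia.
move=> g gB; pose s := [ffun i : 'I_k => inord (absz ((val g i : int) + B%:Z)%R) : 'I_B.*2.+1].
have gs : window s g.
  move=> i; have [zB zE] := shift (val g i) (gB i (ltn_ord i)).
  by rewrite ffunE inordK.
exists (xget 0 (window s)) => [|i ik]; first by exists s.
by rewrite (xgetI 0 gs (Ordinal ik)) (gs (Ordinal ik)).
Qed.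

(** * The group of slow balanced sequences *)

(* The cells occupy positive even coordinates; the odd ones remain free. *)
Definition cell (n m : nat) : nat := (pickle (n, m)).+1.*2.

Lemma cell_inj n m n' m' : cell n m = cell n' m' -> n = n' /\ m = m'.
Proof.
move=> /double_inj[] /(pcan_inj choice.pickleK) [-> ->].
by [].
Qed.

Definition slow (U : set_system nat) (g : nat -> int) : Prop :=
  exists c : nat, \forall n \near U,
    forall i, (i <= n)%N -> `|g i| <= (c * n.+1)%:Z.

(** Asking the partial sums to be eventually constant gives each row a finite support and keeps the
    condition linear. *)
Definition balanced (g : nat -> int) : Prop :=
  forall n, \forall M \near \oo, \sum_(m < M) g (cell n m) = g 0%N.

Definition slow_balanced (U : set_system nat) : pred ZN :=
  fun g => `[< slow U g /\ balanced g >].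

Lemma slow_balanced_zmod_closed (U : set_system nat) :
  Filter U -> GRing.zmod_closed (slow_balanced U).
Proof.
move=> FU; split.
  apply/asboolP; split; first by exists 0%N; apply: nearW => n i _; rewrite normr0.
  by move=> n; apply: nearW => M; rewrite big1.
move=> f g /asboolP[[c cf] bf] /asboolP[[d dg] bg]; apply/asboolP; split.
  exists (c + d)%N; apply: filterS2 cf dg => n fn gn i le_in.
  have := fn i le_in; have := gn i le_in.
  by rewrite -[(f - g) i]/(f i - g i); lia.
move=> n; apply: filterS2 (bf n) (bg n) => M fM gM.
by rewrite -[(f - g) 0%N]/(f 0%N - g 0%N) -fM -gM -sumrB.
Qed.

Definition slow_group (U : set_system nat) (FU : Filter U) : zmodClosed ZN :=
  HB.pack (slow_balanced U)
    (GRing.isZmodClosed.Build ZN (slow_balanced U) (slow_balanced_zmod_closed FU)).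

Definition slow_elem (U : set_system nat) (FU : Filter U) (g : nat -> int)
    (sg : slow U g) (bg : balanced g) : subgroup (slow_group FU) :=
  exist (fun x : ZN => x \in slow_group FU) (g : ZN) (asboolT (conj sg bg)).

Lemma odd_balanced (g : nat -> int) : (forall i, ~~ odd i -> g i = 0) -> balanced g.
Proof.
move=> g0 n; apply: nearW => M; rewrite g0 // big1 // => m _.
by rewrite g0 // odd_double.
Qed.

Lemma bounded_slow (U : set_system nat) (g : nat -> int) :
  Filter U -> (forall i, `|g i| <= 1) -> slow U g.
Proof.
by move=> FU g1; exists 1%N; apply: nearW => n i _; have := g1 i; lia.
Qed.

(** * Boundedness and covering properties of the group *)

(** Let g have constant c, with the bound valid at some m >= [K c]. The largest n with [K n] <= m
    satisfies c <= n and m < [K n.+1], so the entries of g below [K n] are at most c(m + 1) <= n *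
    [K n.+1], the size that [F n] handles. *)
Lemma slow_group_Menger_bounded (U : set_system nat) (FU : Filter U) :
  ProperFilter U -> \oo `<=` U -> Menger_bounded (subgroup (slow_group FU)).
Proof.
move=> PU ooU V V0; have /choice[k kV] n := nbhs0_subgroup (V0 n).
(* The summand n makes [K] strictly increasing and bounds n by [K n], so that a largest n exists. *)
pose K n := (n + \sum_(j < n.+1) k j)%N.
have KS n : (K n < K n.+1)%N by rewrite /K (big_ord_recr n.+1) /=; lia.
have leK n p : (n <= p)%N -> (K n <= K p)%N.
  move=> /subnK <-; elim: (p - n)%N => // q; have := KS (q + n)%N.
  by rewrite addSn; lia.
have lekK n : (k n <= K n)%N by rewrite /K big_ord_recr /=; lia.
have /choice[F FP] n :=
  finite_set_windows (slow_group FU) (K n) (n * K n.+1).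
exists F; split => [n|]; first by have [] := FP n.
apply/seteqP; split => // g _.
have [[c cg] _] : slow U (val g) /\ balanced (val g) by exact/asboolP/(valP g).
have [m [gm Kcm]] : exists m, (forall i, (i <= m)%N ->
    `|val g i| <= (c * m.+1)%:Z) /\ (K c <= m)%N.
  apply: (@filter_ex _ U); apply: filterI cg _.
  (* Sets in [U] meet every final segment, so m can be taken beyond [K c]. *)
  by apply: ooU; exact: nbhs_infty_ge.
have Kbd n : (K n <= m)%N -> (n <= m)%N by rewrite /K; lia.
have [n Knm nmax] := ex_maxnP (ex_intro _ c Kcm) Kbd.
have mK : (m < K n.+1)%N.
  by rewrite ltnNge; apply/negP => /nmax; rewrite ltnn.
have cn := nmax _ Kcm.
have [_ /(_ g)[i iK|a Fa ag]] := FP n.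
  apply: le_trans (gm i _) _; first by lia.
  by rewrite lez_nat leq_mul.
exists n => //; exists a => //; exists (g - a); last by rewrite addrC subrK.
apply: kV => i ik; rewrite val_subgroupB ag ?subrr //.
exact: leq_trans ik (lekK n).
Qed.

(* A value at 2x+1 makes the partial maximum exceed n + 1 only at n between 2x+1
   and that value; when the values are the next terms of a fast sequence t, these
   stretches are disjoint for the terms of even and of odd index, so the
   ultrafilter avoids one of the two families. *)
Lemma slow_group_not_Hurewicz_bounded (U : set_system nat) (FU : Filter U) :
  UltraFilter U -> ~ Hurewicz_bounded (subgroup (slow_group FU)).
Proof.
move=> UU /(_ (fun n => [set g : subgroup (slow_group FU) | val g n.*2.+1 = 0])).
case=> [n|F [finF HF]]; first exact: nbhs0_coord.
have /choice[h hP] n : exists b : nat, forall a, F n a -> `|val a n.*2.+1| <= b%:Z.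
  have /finite_seqP[s sE] : finite_set [set `|val a n.*2.+1|%N | a in F n].
    exact: finite_image.
  exists (\max_(i <- s) i) => a Fa.
  have : `|val a n.*2.+1|%N \in s.
    by have : [set` s] `|val a n.*2.+1|%N by rewrite -sE; exists a.
  by move=> /(@leq_bigmax_seq _ s xpredT id _)/(_ isT); lia.
(* Exceeding x makes [t] increase; exceeding [h x] puts the value at 2x+1 out of reach of [F x]. *)
pose next x := (maxn x (h x)).+1.
pose t j := iter j next 0%N.
have tS j : (t j < t j.+1)%N by rewrite /= ltnS leq_max leqnn.
have let_ j l : (j <= l)%N -> (t j <= t l)%N.
  move=> /subnK <-; elim: (l - j)%N => // q; have := tS (q + j)%N.
  by rewrite addSn; lia.
have tlt j l : (t j < t l.+1)%N -> (j <= l)%N.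
  by move=> jl; rewrite leqNgt; apply/negP => /let_; lia.
(* Halving matches coordinates with indices: 2x+1 <= n implies x <= [n./2]. *)
pose gap b := [set n | exists j, [/\ odd j = b, t j <= n./2 & n./2 < t j.+1]%N].
have [b Ub] : exists b, U (~` gap b).
  have [Ut|Ut] := in_ultra_setVsetC (gap true) UU; last by exists true.
  exists false; apply: filterS Ut => n [j [jo j1 j2]] [l [lo l1 l2]].
  have jl : (j <= l)%N by apply: tlt; lia.
  have lj : (l <= j)%N by apply: tlt; lia.
  have : j = l by lia.
  by move=> jE; move: jo; rewrite jE lo.
pose jump i := odd i && `[< exists2 j, odd j = b & t j = i./2 >].
pose g i : int := if jump i then (next i./2)%:Z else 0.
have sg : slow U g.
  exists 1%N; apply: filterS Ub => n ngap i le_in; rewrite mul1n /g.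
  case: ifP => [/andP[io /asboolP[j jb tj]]|_]; last by rewrite normr0.
  rewrite -tj -[next (t j)]/(t j.+1).
  have tn : (t j <= n./2)%N by rewrite tj half_leq.
  have [tn'|tn'] := ltnP n./2 (t j.+1); last by lia.
  by case: ngap; exists j.
have bg : balanced g.
  by apply: odd_balanced => i /negbTE io; rewrite /g /jump io.
have [N _ NP] := HF (slow_elem FU sg bg).
(* An index of parity [b] that is at least N, hence with [t j] >= N. *)
pose j := (N.*2 + b)%N.
have jb : odd j = b by rewrite oddD odd_double; case: (b).
have jt q : (q <= t q)%N by elim: q => // q IH; have := tS q; lia.
have /NP[a Fa [u u0 au]] : (N <= t j)%N by have := jt j; lia.
have := hP _ _ Fa.
have : val (a + u) (t j).*2.+1 = g (t j).*2.+1 by rewrite au.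
rewrite val_subgroupD u0 addr0 => ->.
rewrite /g /jump /= odd_double /= uphalf_double.
rewrite asboolT; last by exists j.
by rewrite /next; lia.
Qed.

(** The n-th neighborhood freezes coordinate 2n+1, where the 0/1 sequence [g] is made to differ from
    [a n]. *)
Lemma slow_group_not_Rothberger_bounded (U : set_system nat) (FU : Filter U) :
  ~ Rothberger_bounded (subgroup (slow_group FU)).
Proof.
move=> /(_ (fun n => [set g : subgroup (slow_group FU) | val g n.*2.+1 = 0])).
case=> [n|a aT]; first exact: nbhs0_coord.
pose g i : int := if odd i && (val (a i./2) i == 0) then 1 else 0.
have sg : slow U g by apply: bounded_slow => i; rewrite /g; case: ifP.
have bg : balanced g by apply: odd_balanced => i /negbTE io; rewrite /g io.
have : [set: subgroup (slow_group FU)] (slow_elem FU sg bg) by [].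
rewrite -aT => -[n _ [u u0 au]].
have : val (a n + u) n.*2.+1 = g n.*2.+1 by rewrite au.
rewrite val_subgroupD u0 addr0.
rewrite /g /= odd_double /= uphalf_double.
by case: eqP => // ->.
Qed.

(* The element 1 at the root and 1 at the cells (n, alpha n) lies in the n-th
   cover only through its member number alpha n; a balanced element with a nonzero
   root has a nonzero entry in each row, so these are indeed covers. *)
Lemma slow_group_not_Menger (U : set_system nat) (FU : Filter U) :
  ~ Menger (subgroup (slow_group FU)).
Proof.
set G := subgroup _.
pose Z : set G := [set g : G | val g 0%N = 0].
pose O n m : set G := [set g : G | val g (cell n m) != 0].
move=> /(_ (fun n => Z |` range (O n))); case=> [n|F [FP FT]].
  split.
    move=> _ [->|[m _ <-]]; first exact: (@open_subgroup_coord _ 0 [set 0]).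
    exact: (@open_subgroup_coord _ (cell n m) [set x | x != 0]).
  apply/seteqP; split => // g _.
  have [g0|g0] := eqVneq (val g 0%N) 0; first by exists Z => //; left.
  have [_ bg] : slow U (val g) /\ balanced (val g) by exact/asboolP/(valP g).
  have [M _ /(_ M (leqnn M)) sM] := bg n.
  have [m gm] : exists m : 'I_M, val g (cell n m) != 0.
    apply/existsP; apply: contra_neqT g0 => /existsPn gz.
    by rewrite -sM big1 // => m _; apply/eqP; have := gz m; rewrite negbK.
  by exists (O n m) => //; right; exists (m : nat).
(* The default 0 is taken at sets that are no [O n m]; it only adds one value for [alpha n] to
   avoid. *)
pose index n V := xget 0%N [set m | V = O n m].
have /choice[alpha alphaP] n : exists m, ~ (index n @` F n) m.
  apply: contrapT => /forallNP nF; apply: infinite_nat.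
  have [finF _] := FP n.
  apply: sub_finite_set (finite_image (index n) finF) => m _.
  exact: contrapT (nF m).
pose x i : int := if (i == 0)%N || `[< exists n, i = cell n (alpha n) >] then 1 else 0.
have xcell n m : x (cell n m) = (m == alpha n)%:Z.
  rewrite /x /=; case: asboolP => [[n' /cell_inj[-> ->]]|nx]; first by rewrite eqxx.
  by case: eqP => // mE; case: nx; exists n; rewrite mE.
have sx : slow U x by apply: bounded_slow => i; rewrite /x; case: ifP.
have bx : balanced x.
  move=> n; apply: filterS (nbhs_infty_gt (alpha n)) => M aM.
  rewrite (bigD1 (Ordinal aM)) //= xcell eqxx big1 ?addr0 // => m.
  by rewrite xcell -val_eqE /= => /negbTE ->.
have : [set: G] (slow_elem FU sx bx) by [].
rewrite -FT => -[n _ [V FV Vx]].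
have [_ /(_ V FV)[VZ|[m _ VE]]] := FP n; first by move: Vx; rewrite VZ.
have VO : V = O n (index n V) by apply: (@xgetPex _ 0%N [set m | V = O n m]); exists m.
move: Vx; rewrite VO /O /= xcell; have [iE _|//] := eqVneq (index n V) (alpha n).
by apply: (alphaP n); exists V.
Qed.

Theorem theorem9p8 :
  exists H : zmodClosed ZN,
    Menger_bounded (subgroup H) /\
    ~ Hurewicz_bounded (subgroup H) /\
    ~ Rothberger_bounded (subgroup H) /\
    ~ Hurewicz (subgroup H) /\
    ~ Menger (subgroup H) /\
    ~ Rothberger (subgroup H).
Proof.
have [U [UU ooU]] := ultraFilterLemma eventually_filter.
have PU : ProperFilter U := @ultra_proper _ U UU.
have FU : Filter U by exact: PU.
have nM := @slow_group_not_Menger U FU.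
exists (slow_group FU); split; first exact: slow_group_Menger_bounded.
split; first exact: slow_group_not_Hurewicz_bounded.
split; first exact: slow_group_not_Rothberger_bounded.
split; first by move/Hurewicz_Menger.
by split=> // /Rothberger_Menger.
Qed.
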